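(* Let $\varkappa$ be a positive integer and let $T$ be a subset of $\mathbb Z^\varkappa$ such that $0\in T=-T$. Then the set $\Sigma_T^2(\mathbb T^\varkappa)$ is dense in $\mathscr P_T^+(\mathbb T^\varkappa)$ with respect to the finest locally convex topology on $\mathcal P_T(\mathbb T^\varkappa)$. In particular, this is the case for the topology of uniform convergence on $\mathbb T^\varkappa$ and the topology given by the norm $\|\cdot\|_{\mathrm{co}}'$.
   Context: $\mathbb T=\{z\in\mathbb C\colon|z|=1\}$, $\mathbb Z_+=\{0,1,2,\dots\}$. For $z\in\mathbb T^\varkappa$ and $\alpha\in\mathbb Z^\varkappa$, $z^\alpha=z_1^{\alpha_1}\cdots z_\varkappa^{\alpha_\varkappa}$. For $T\subset\mathbb Z^\varkappa$, $\mathcal P_T(\mathbb T^\varkappa)$ is the linear space of all trigonometric polynomials $p(z)=\sum_{\alpha\in T}a_\alpha z^\alpha$, $z\in\mathbb T^\varkappa$, with finitely many nonzero coefficients $a_\alpha\in\mathbb C$; $\mathcal P_+(\mathbb T^\varkappa)=\mathcal P_{\mathbb Z_+^\varkappa}(\mathbb T^\varkappa)$ (analytic trigonometric polynomials). $\mathscr P_T^+(\mathbb T^\varkappa)$ is the set of all $q\in\mathcal P_T(\mathbb T^\varkappa)$ with $q(z)\ge0$ for all $z\in\mathbb T^\varkappa$. $\Sigma_T^2(\mathbb T^\varkappa)$ is the set of all $q\in\mathcal P_T(\mathbb T^\varkappa)$ for which there exist finitely many $q_1,\dots,q_k\in\mathcal P_+(\mathbb T^\varkappa)$ with $q(z)=\sum_{j=1}^k|q_j(z)|^2$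 for all $z\in\mathbb T^\varkappa$. For $p(z)=\sum_{\alpha\in\mathbb Z^\varkappa}a_\alpha z^\alpha$, $\|p\|_{\mathrm{co}}'=\max\{|a_\alpha|\colon\alpha\in\mathbb Z^\varkappa\}$. The finest locally convex topology on a linear space $V$ is the one given by the family of all seminorms on $V$. *)

(* Defs.v *)
From HB Require Import structures.
From mathcomp Require Import all_boot all_order all_algebra.
From mathcomp Require Import complex finmap.
From mathcomp Require Import all_classical all_reals.
From mathcomp Require Import topology normedtype.
From mathcomp Require Import ring.
From mathcomp Require monalg.
(* The notations of monalg do not coexist with those of MathComp-Analysis. *)
Export -(notations) monalg.
Export numFieldNormedType.Exports.

Set Implicit Arguments.
Unset Strict Implicit.
Unset Printing Implicit Defensive.

Import Order.TTheory GRing.Theory Num.Theory.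
Local Open Scope ring_scope.
Local Open Scope complex_scope.
Local Open Scope classical_set_scope.

Definition dense_in (X : topologicalType) (A B : set X) : Prop :=
  A `<=` B /\ B `<=` closure A.

Section Seminorms.
Variables (R : realType) (V : lmodType R[i]).

Definition seminorm (nu : V -> R) : Prop :=
  (forall x y, nu (x + y) <= nu x + nu y) /\
  (forall c x, nu (c *: x) = Normc.normc c * nu x).

Definition seminorm_open (S : set (V -> R)) (U : set V) : Prop :=
  forall x, U x -> exists m (nu : 'I_m -> V -> R) (e : R),
    [/\ 0 < e, forall i, S (nu i) &
        [set y | forall i, nu i (y - x) < e] `<=` U].

(* V with the topology given by the family S, intended to be a set of
   seminorms on V. *)
Definition seminorm_space (S : set (V -> R)) : Type := V.

Section Topology.
Variable S : set (V -> R).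

Let openT : seminorm_open S setT.
Proof.
by move=> x _; exists 0%N, (fun _ _ => 0), 1; split=> // -[].
Qed.

Let openI : setI_closed (seminorm_open S).
Proof.
move=> A B oA oB x [/oA[m [f [e [e0 Sf fA]]]] /oB[n [g [d [d0 Sg gB]]]]].
exists (m + n)%N,
  (fun i => match fintype.split i with inl j => f j | inr j => g j end),
  (Num.min e d); split.
- by rewrite lt_min e0 d0.
- by move=> i; case: fintype.split.
- move=> y Hy; split.
  + apply: fA => j; have := Hy (lshift n j).
    by rewrite -[lshift n j]/(unsplit (inl j)) unsplitK lt_min => /andP[].
  + apply: gB => j; have := Hy (rshift m j).
    by rewrite -[rshift m j]/(unsplit (inr j)) unsplitK lt_min => /andP[].
Qed.

Let open_bigU (I : Type) (f : I -> set V) :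
  (forall i, seminorm_open S (f i)) -> seminorm_open S (\bigcup_i f i).
Proof.
move=> openf x [i _ /openf[m [nu [e [e0 Snu sub]]]]].
by exists m, nu, e; split=> // y /sub ?; exists i.
Qed.

HB.instance Definition _ := Choice.on (seminorm_space S).
HB.instance Definition _ :=
  isOpenTopological.Build (seminorm_space S) openT openI open_bigU.

End Topology.

Definition finest_lc : Type := seminorm_space [set nu | seminorm nu].
HB.instance Definition _ := Topological.on finest_lc.

End Seminorms.

Section TrigPoly.
Variables (R : realType) (n : nat).

Definition torus : set 'rV[R[i]]_n := [set z | forall i, `|z ord0 i| = 1].

Definition zmonom (z : 'rV[R[i]]_n) (a : 'rV[int]_n) : R[i] :=
  \prod_(i < n) z ord0 i ^ a ord0 i.

(* A trigonometric polynomial with exponents in T is its finitely supported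
   family of coefficients, which is determined by the associated function on
   the torus: see trig_eval_inj below. *)
Definition trigpoly (T : set 'rV[int]_n) : Type := malg T R[i].
HB.instance Definition _ (T : set 'rV[int]_n) :=
  GRing.Lmodule.on (trigpoly T).

Definition trig_eval (T : set 'rV[int]_n) (p : trigpoly T) :
    'rV[R[i]]_n -> R[i]^o :=
  fun z => \sum_(a <- msupp p) mcoeff a p * zmonom z (val a).

Definition Zplus : set 'rV[int]_n := [set a | forall i, 0 <= a ord0 i].

(* On R[i] the order 0 <= w means that w is real and nonnegative. *)
Definition nonneg_trigpoly (T : set 'rV[int]_n) : set (trigpoly T) :=
  [set q | forall z, torus z -> 0 <= trig_eval q z].

Definition sos_trigpoly (T : set 'rV[int]_n) : set (trigpoly T) :=
  [set q | exists s : seq (trigpoly Zplus), forall z, torus z ->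
     trig_eval q z = \sum_(r <- s) `|trig_eval r z| ^+ 2].

Definition co_norm (T : set 'rV[int]_n) (p : trigpoly T) : R :=
  \big[Num.max/0]_(a <- msupp p) Normc.normc (mcoeff a p).

Definition co_normed (T : set 'rV[int]_n) : Type :=
  seminorm_space [set @co_norm T].
HB.instance Definition _ (T : set 'rV[int]_n) :=
  Topological.on (co_normed T).

Definition unif_conv (T : set 'rV[int]_n) : Type :=
  initial_topology
    (@trig_eval T : trigpoly T -> {uniform` torus -> R[i]^o}).
HB.instance Definition _ (T : set 'rV[int]_n) :=
  Topological.on (unif_conv T).

Lemma zmonom_mul (z w : 'rV[R[i]]_n) (a : 'rV[int]_n) :
  zmonom (\row_i (z ord0 i * w ord0 i)) a = zmonom z a * zmonom w a.
Proof.
by rewrite /zmonom -big_split /=; apply: eq_bigr => i _; rewrite mxE expfzMl.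
Qed.

Lemma zmonom_separated (a b : 'rV[int]_n) : a != b ->
  exists2 z, torus z & zmonom z a != zmonom z b.
Proof.
move=> ab; have [i abi] : exists i, a ord0 i != b ord0 i.
  apply/existsP; apply: contraNT ab; rewrite negb_exists => /forallP ab.
  by apply/eqP/rowP => i; apply/eqP; move: (ab i); rewrite negbK.
set m := `|(a ord0 i - b ord0 i)%R|%N.
have m0 : (0 < m)%N by rewrite absz_gt0 subr_eq0.
pose w : R[i] := m.-root (-1).
have wm : w ^+ m = -1 by rewrite /w rootCK.
have w1 : `|w| = 1 by rewrite /w norm_rootC normrN1 rootC1.
have w0 : w != 0 by rewrite -normr_eq0 w1 oner_eq0.
have zE c : zmonom (\row_j if j == i then w else 1) c = w ^ c ord0 i.
  rewrite /zmonom (bigD1 i) //= mxE eqxx big1 ?mulr1 // => j /negPf ji.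
  by rewrite mxE ji exp1rz.
exists (\row_j if j == i then w else 1).
  by move=> j; rewrite mxE; case: ifP => // _; rewrite normr1.
rewrite !zE; apply/eqP => ww.
have : w ^ (a ord0 i - b ord0 i) = 1.
  by rewrite expfzDr // -invr_expz ww mulfV // expfz_neq0.
have N1 : (-1 : R[i]) != 1 by rewrite eq_sym -subr_eq0 opprK -[1 + 1]/(2%:R) pnatr_eq0.
have [->|->] : a ord0 i - b ord0 i = m :> int \/ a ord0 i - b ord0 i = - m%:Z.
- by rewrite /m; case: (a ord0 i - b ord0 i) => k; [left|right].
- by rewrite -exprnP wm => /eqP; rewrite (negPf N1).
- by rewrite -invr_expz -exprnP wm invrN1 => /eqP; rewrite (negPf N1).
Qed.

Lemma zmonom_free (s : seq 'rV[int]_n) (c : 'rV[int]_n -> R[i]) : uniq s ->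
  (forall z, torus z -> \sum_(a <- s) c a * zmonom z a = 0) ->
  {in s, forall a, c a = 0}.
Proof.
elim: s c => // b s IH c /= /andP[bs us] sum0.
have cs a : a \in s -> c a = 0.
  move=> sa; have ab : a != b by apply: contraNneq bs => <-.
  have [z tz zab] := zmonom_separated ab.
  have : c a * (zmonom z a - zmonom z b) = 0.
    apply: (IH (fun a => c a * (zmonom z a - zmonom z b))) => // w tw.
    have tzw : torus (\row_i (z ord0 i * w ord0 i)).
      by move=> i; rewrite mxE normrM tz tw mulr1.
    rewrite -[RHS](subrr 0) -[X in _ = X - _](sum0 _ tzw).
    rewrite -[X in _ = _ - X](mulr0 (zmonom z b)) -[X in _ = _ - _ * X](sum0 _ tw).
    rewrite mulr_sumr -sumrB big_cons zmonom_mul.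
    rewrite [X in _ = X + _](_ : _ = 0) ?add0r; last by ring.
    by apply: eq_bigr => d _; rewrite zmonom_mul; ring.
  by move=> /eqP; rewrite mulf_eq0 subr_eq0 (negPf zab) orbF => /eqP.
move=> a; rewrite in_cons => /predU1P[->|/cs//].
have t1 : torus (const_mx 1 : 'rV[R[i]]_n) by move=> i; rewrite mxE normr1.
have := sum0 _ t1; rewrite big_cons big_seq big1 => [|d /cs ->]; last first.
  by rewrite mul0r.
rewrite addr0 /zmonom big1 ?mulr1 // => i _; by rewrite mxE exp1rz.
Qed.

Lemma trig_evalB (T : set 'rV[int]_n) (p q : trigpoly T) z :
  trig_eval (p - q) z = trig_eval p z - trig_eval q z.
Proof.
have E : forall r : trigpoly T,
    trig_eval r z = mmap idfun (fun a : T => zmonom z (val a)) r by [].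
by rewrite !E raddfB.
Qed.

Lemma trig_eval_inj (T : set 'rV[int]_n) (p q : trigpoly T) :
  (forall z, torus z -> trig_eval p z = trig_eval q z) -> p = q.
Proof.
move=> pq; apply/eqP; rewrite -subr_eq0; apply/eqP.
have {pq} : forall z, torus z -> trig_eval (p - q) z = 0.
  by move=> z /pq pqz; rewrite trig_evalB pqz subrr.
move: (p - q) => {p q} r r0.
pose c (a : 'rV[int]_n) : R[i] :=
  if insub a is Some t then mcoeff (t : T) r else 0.
have cE (t : T) : c (val t) = mcoeff t r by rewrite /c valK.
apply/malgP => t; rewrite mcoeff0.
have [tr|] := boolP (t \in msupp r); last exact: mcoeff_outdom.
rewrite -cE; apply: (@zmonom_free (map val (msupp r))).
- by rewrite map_inj_uniq ?fset_uniq//; exact: val_inj.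
- move=> z /r0; rewrite /trig_eval big_map => rz.
  by under eq_bigr do rewrite cE.
- exact: map_f.
Qed.

End TrigPoly.

Arguments torus {R n}.
Arguments Zplus {n}.
Arguments nonneg_trigpoly {R n} T.
Arguments sos_trigpoly {R n} T.
Arguments unif_conv R {n} T.
Arguments co_normed R {n} T.

(* Main.v *)
Require Import Defs.
From mathcomp Require Import all_boot all_order all_algebra.
From mathcomp Require Import complex all_classical all_reals topology normedtype.
From mathcomp Require Import finmap cyclic separable cyclotomic zify lra.

Import Order.TTheory GRing.Theory Num.Theory.

Local Open Scope ring_scope.
Local Open Scope classical_set_scope.

(* The Fejer means of [q] are obtained by multiplying the coefficient of
   [z ^ a] by [\prod_i (1 - |a_i| / N)_+], so their exponents stay in [T] and
   they tend to [q] in every seminorm.  They are the convolution of [q] with the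
   squared modulus of an analytic polynomial (a product of one-variable Dirichlet
   kernels).  For a trigonometric polynomial this convolution is a finite average
   over the points [w] whose coordinates are [m]-th roots of unity, with [m]
   large; as [q w >= 0], the average is a sum of squares of analytic
   polynomials. *)

(** * Roots of unity and their orthogonality relations *)

(** In characteristic 0 the polynomial ['X^m - 1] is separable, so it has [m] distinct roots; a set
    of [m] distinct [m]-th roots of unity contains a primitive one. *)
Lemma prim_root_exists {C : numClosedFieldType} {m : nat} :
  (0 < m)%N -> exists w : C, m.-primitive_root w.
Proof.
move=> m_gt0; have [r Dp] := closed_field_poly_normal ('X^m - 1 : {poly C}).
rewrite (monicP _) ?monicXnsubC// scale1r in Dp.
have rm1 : all m.-unity_root r by apply/allP => w; rewrite -root_prod_XsubC -Dp.
have sz_r : (m < (size r).+1)%N.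
  by rewrite -(size_prod_XsubC r id) -Dp size_XnsubC.
have [|w] := hasP (has_prim_root m_gt0 rm1 _ sz_r); last by exists w.
by rewrite -separable_prod_XsubC -Dp separable_Xn_sub_1// pnatr_eq0 -lt0n.
Qed.

Lemma prim_root_neq0 {F : fieldType} {m : nat} {w : F} :
  m.-primitive_root w -> w != 0.
Proof.
move=> pw; apply/eqP => w0; have := prim_expr_order pw; apply/eqP.
by rewrite w0 expr0n eqn0Ngt (prim_order_gt0 pw) eq_sym oner_eq0.
Qed.

Lemma prim_root_norm {C : numClosedFieldType} {m : nat} {w : C} :
  m.-primitive_root w -> `|w| = 1.
Proof.
move=> pw; apply/eqP; rewrite -(pexpr_eq1 (prim_order_gt0 pw))// -normrX.
by rewrite (prim_expr_order pw) normr1.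
Qed.

Lemma prim_expz_eq1 {F : fieldType} {m : nat} {w : F} (j : int) :
  m.-primitive_root w -> (`|j| < m)%N -> (w ^ j == 1) = (j == 0).
Proof.
move=> pw jm.
have absE k : (k < m)%N -> (w ^+ k == 1) = (k == 0)%N.
  by move=> km; rewrite -(prim_order_dvd pw) /dvdn modn_small.
case: j jm => k /= km; first by rewrite -exprnP absE.
by rewrite NegzE -invr_expz invr_eq1 -exprnP absE.
Qed.

(** A geometric sum with ratio [w ^ j]; the bound on [j] ensures that this ratio is 1 only for
    [j = 0]. *)
Lemma sum_prim_expz {F : fieldType} {m : nat} {w : F} (j : int) :
  m.-primitive_root w -> (`|j| < m)%N ->
  \sum_(k < m) (w ^+ k) ^ j = (m * (j == 0))%:R.
Proof.
move=> pw jm.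
have powC k : (w ^+ k) ^ j = (w ^ j) ^+ k by rewrite !exprnP exprzAC.
under eq_bigr do rewrite powC.
rewrite -(prim_expz_eq1 j pw jm); have [->|x1] := eqVneq (w ^ j) 1.
  by under eq_bigr do rewrite expr1n; rewrite sumr_const card_ord muln1.
rewrite muln0; apply/eqP; have := subrX1 (w ^ j) m.
rewrite -powC (prim_expr_order pw) exp1rz subrr => /esym/eqP.
by rewrite mulf_eq0 subr_eq0 (negPf x1).
Qed.

(** * Fejer weights in one variable *)

(* Its exact value is [(N - |a|)_+]; the two bounds below are enough. *)
Definition fejer_count (N : nat) (a : int) : nat :=
  (\sum_(b < N) \sum_(c < N) (a == (b%:Z - c%:Z)%R))%N.

Lemma fejer_countN N a : fejer_count N (- a) = fejer_count N a.
Proof.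
rewrite /fejer_count exchange_big; apply: eq_bigr => b _; apply: eq_bigr => c _.
by congr nat_of_bool; lia.
Qed.

(** For each [b], at most one [c] satisfies [a = b - c]. *)
Lemma fejer_count_le N a : (fejer_count N a <= N)%N.
Proof.
rewrite -[leqRHS]card_ord -sum1_card; apply: leq_sum => b _.
have [/existsP[c ac]|] := boolP [exists c : 'I_N, a == b%:Z - c%:Z].
  rewrite (bigD1 c)//= ac big1// => d dc; apply/eqP.
  by rewrite eqb0; apply: contra dc => ad; rewrite -val_eqE/=; lia.
rewrite negb_exists => /forallP nac; rewrite big1// => c _.
by rewrite (negPf (nac c)).
Qed.

(** By symmetry [a = k >= 0]; then each [b >= k] is counted through [c = b - k], which gives at
    least [N - k] pairs. *)
Lemma fejer_count_ge N a : (N <= fejer_count N a + `|a|)%N.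
Proof.
wlog [k ->] : a / exists k : nat, a = k%:Z.
  by case: a => k wl; [|rewrite NegzE fejer_countN abszN]; apply: wl; eexists.
have : (\sum_(b < N) (k <= b)%N <= fejer_count N k)%N.
  apply: leq_sum => b _; case kb: (k <= b)%N => //.
  have cN : (b - k < N)%N by rewrite (leq_ltn_trans (leq_subr _ _)).
  by rewrite (bigD1 (Ordinal cN))//= (_ : _ == _) //; lia.
suff -> : (\sum_(b < N) (k <= b)%N = N - k)%N by lia.
elim: N => [|N IH]; first by rewrite big_ord0.
by rewrite big_ord_recr/= IH; lia.
Qed.

(** The squared modulus expands into powers [b - c] of [z / w ^+ k], and summation over [k] keeps
    only the pairs with [b - c = a]. As [|b - c| < N], the bound on [m] excludes aliasing. *)
Lemma fejer_sum {C : numClosedFieldType} {m N : nat} {w : C} (a : int) (z : C) :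
  m.-primitive_root w -> (`|a| + N <= m)%N -> `|z| = 1 ->
  \sum_(k < m) (w ^+ k) ^ a * `|\sum_(b < N) (z / w ^+ k) ^+ b| ^+ 2
  = (m * fejer_count N a)%:R * z ^ a.
Proof.
move=> pw aNm z1.
have w0 : w != 0 := prim_root_neq0 pw.
have z0 : z != 0 by rewrite -normr_eq0 z1 oner_eq0.
have w1 : `|w| = 1 := prim_root_norm pw.
have sqE k : `|\sum_(b < N) (z / w ^+ k) ^+ b| ^+ 2 =
    \sum_(b < N) \sum_(c < N) (z / w ^+ k) ^ (b%:Z - c%:Z).
  have u1 : `|z / w ^+ k| = 1.
    by rewrite normrM z1 normfV normrX w1 expr1n invr1 mulr1.
  have u0 : z / w ^+ k != 0 by rewrite -normr_eq0 u1 oner_eq0.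
  rewrite normCK rmorph_sum/= big_distrlr/=.
  apply: eq_bigr => b _; apply: eq_bigr => c _.
  rewrite expfzDr// -invr_expz -!exprnP rmorphXn/= -exprVn; congr (_ * _ ^+ _).
  (* On the unit circle, conjugation is inversion. *)
  by apply: (mulfI u0); rewrite -normCK u1 expr1n mulfV.
transitivity (\sum_(b < N) \sum_(c < N)
    z ^ (b%:Z - c%:Z) * \sum_(k < m) (w ^+ k) ^ (a - (b%:Z - c%:Z))).
  under eq_bigr do rewrite sqE mulr_sumr.
  rewrite exchange_big; apply: eq_bigr => b _.
  under eq_bigr do rewrite mulr_sumr.
  rewrite exchange_big; apply: eq_bigr => c _.
  rewrite mulr_sumr; apply: eq_bigr => k _.
  by rewrite expfzMl exprz_inv (expfzDr a) ?expf_neq0// mulrCA.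
rewrite /fejer_count big_distrr natr_sum mulr_suml; apply: eq_bigr => b _.
rewrite big_distrr natr_sum mulr_suml; apply: eq_bigr => c _.
rewrite (sum_prim_expz _ pw); last by have := ltn_ord b; have := ltn_ord c; lia.
rewrite subr_eq0 /=; case: eqP => [->|_]; first by rewrite mulrC.
by rewrite muln0 mulr0 mul0r.
Qed.

(** Induction from [1 - x p = (1 - x) + x (1 - p) <= (1 - x) + (1 - p)], which uses [x <= 1] and
    [p <= 1]; hence the bounds on the product are proved along with it. *)
Lemma prod_ge_1Bsum {F : realDomainType} {I : finType} (x : I -> F) (r : seq I) :
  (forall i, 0 <= x i <= 1) ->
  0 <= \prod_(i <- r) x i <= 1 /\
  1 - \prod_(i <- r) x i <= \sum_(i <- r) (1 - x i).
Proof.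
move=> x01; elim: r => [|i r [/andP[p0 p1] IH]].
  by rewrite !big_nil subrr lexx ler01.
have /andP[xi0 xi1] := x01 i; rewrite !big_cons.
by split; [apply/andP; split|]; nra.
Qed.

(** * Linearity of evaluation *)

Section TrigEval.
Context {R : realType} {n : nat} {T : set 'rV[int]_n}.
Implicit Types (p q : trigpoly R T) (z : 'rV[R[i]]_n).

Lemma trig_evalE p z :
  trig_eval p z = mmap idfun (fun a : T => zmonom z (val a)) p.
Proof. by []. Qed.

Lemma trig_evalZ c p z : trig_eval (c *: p) z = c * trig_eval p z.
Proof.
rewrite malgZ_def !trig_evalE raddf_sum mmapE mulr_sumr.
by apply: eq_bigr => a _; rewrite /= mmapU mulrA.
Qed.

Lemma trig_evalD p q z : trig_eval (p + q) z = trig_eval p z + trig_eval q z.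
Proof. by rewrite !trig_evalE raddfD. Qed.

Lemma trig_evalU (a : T) c z : trig_eval (mkmalgU a c) z = c * zmonom z (val a).
Proof. by rewrite trig_evalE mmapU. Qed.

Lemma trig_eval_sum (I : Type) (r : seq I) (P : pred I) (F : I -> trigpoly R T) z :
  trig_eval (\sum_(i <- r | P i) F i) z = \sum_(i <- r | P i) trig_eval (F i) z.
Proof. by rewrite trig_evalE raddf_sum. Qed.

End TrigEval.

(** * Fejer means as sums of squares *)

Section FejerMean.
Context {R : realType} {n : nat}.

Section AnalyticKernel.
Variables (N : nat) (c : R[i]) (u : 'I_n -> R[i]).

Definition kernel_exponent (g : {ffun 'I_n -> 'I_N}) : 'rV[int]_n :=
  \row_i (g i)%:Z.

Lemma kernel_exponent_Zplus g : kernel_exponent g \in Zplus.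
Proof. by apply/mem_set => i; rewrite mxE. Qed.

(** A scaled product of Dirichlet kernels, expanded into monomials so that analyticity is visible
    term by term. *)
Definition analytic_kernel : trigpoly R Zplus :=
  \sum_(g : {ffun 'I_n -> 'I_N})
    mkmalgU (SigSub (kernel_exponent_Zplus g)) (c * \prod_i u i ^+ g i).

Lemma analytic_kernelE (z : 'rV[R[i]]_n) :
  trig_eval analytic_kernel z =
  c * \prod_i \sum_(b < N) (z ord0 i * u i) ^+ b.
Proof.
rewrite bigA_distr_bigA mulr_sumr trig_eval_sum; apply: eq_bigr => g _.
rewrite trig_evalU -mulrA; congr (_ * _).
rewrite /zmonom -big_split; apply: eq_bigr => i _ /=.
by rewrite mxE exprMn mulrC.
Qed.

End AnalyticKernel.

Definition fejer_coef (N : nat) (a : 'rV[int]_n) : R :=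
  \prod_i ((fejer_count N (a ord0 i))%:R / N%:R).

Lemma fejer_coef_close N a : (0 < N)%N ->
  `|fejer_coef N a - 1| <= (\sum_i `|a ord0 i|%N)%:R / N%:R.
Proof.
move=> N0; have N0' : 0 < N%:R :> R by rewrite ltr0n.
have [|/andP[_ c1] cge] := @prod_ge_1Bsum R _
    (fun i => (fejer_count N (a ord0 i))%:R / N%:R) (index_enum 'I_n).
  move=> i; rewrite divr_ge0 ?ler0n//= ler_pdivrMr// mul1r ler_nat.
  exact: fejer_count_le.
rewrite distrC ger0_norm ?subr_ge0//; apply: le_trans cge _.
rewrite natr_sum mulr_suml; apply: ler_sum => i _.
rewrite -[X in X - _](divff (lt0r_neq0 N0')) -mulrBl ler_pM2r ?invr_gt0//.
by rewrite lerBlDl -natrD ler_nat fejer_count_ge.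
Qed.

(** The points form a product grid, so the sum over [f] factors into one-variable sums, each
    evaluated by [fejer_sum]. *)
Lemma fejer_sum_row {m N : nat} {w : R[i]} (a : 'rV[int]_n) (z : 'rV[R[i]]_n) :
  (0 < N)%N -> m.-primitive_root w ->
  (forall i, (`|a ord0 i| + N <= m)%N) -> torus z ->
  \sum_(f : {ffun 'I_n -> 'I_m}) zmonom (\row_i w ^+ f i) a *
     `|\prod_i \sum_(b < N) (z ord0 i / w ^+ f i) ^+ b| ^+ 2
  = ((m * N) ^ n)%:R * (((fejer_coef N a)%:C)%C * zmonom z a).
Proof.
move=> N0 pw am tz; have m0 := prim_order_gt0 pw.
transitivity (\prod_i \sum_(k < m) (w ^+ k) ^ a ord0 i *
    `|\sum_(b < N) (z ord0 i / w ^+ k) ^+ b| ^+ 2).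
  rewrite bigA_distr_bigA; apply: eq_bigr => f _.
  rewrite normr_prod -prodrXl [RHS]big_split/=; congr (_ * _).
  by apply: eq_bigr => i _; rewrite mxE.
have -> : ((m * N) ^ n)%:R = \prod_(i < n) (m * N)%:R :> R[i].
  by rewrite prodr_const card_ord natrX.
rewrite /fejer_coef rmorph_prod -!big_split; apply: eq_bigr => i _ /=.
rewrite (fejer_sum _ _ pw (am i) (tz i)) mulrA; congr (_ * _).
have -> (x : R) : ((x / N%:R)%:C = x%:C / N%:R)%C.
  by rewrite [LHS]rmorphM [X in _ * X]fmorphV; congr (_ / _); exact: rmorph_nat.
rewrite rmorph_nat !natrM -mulrA; congr (_ * _).
by rewrite mulrCA mulfV ?mulr1// pnatr_eq0 -lt0n.
Qed.

Section Mean.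
Context {T : set 'rV[int]_n}.
Implicit Types q : trigpoly R T.

Definition fejer_mean (N : nat) q : trigpoly R T :=
  \sum_(a <- msupp q) ((fejer_coef N (val a))%:C)%C *: mkmalgU a (mcoeff a q).

Lemma fejer_mean_sos N q : (0 < N)%N -> nonneg_trigpoly T q ->
  sos_trigpoly T (fejer_mean N q).
Proof.
move=> N0 q0.
(* [A] bounds every coordinate of every exponent of [q], so one [m] serves the whole support. *)
pose A := (\sum_(a <- msupp q) \sum_i `|val a ord0 i|)%N.
pose m := (A + N)%N.
have m0 : (0 < m)%N by rewrite addn_gt0 N0 orbT.
have [w pw] := @prim_root_exists R[i] m m0.
have w1 : `|w| = 1 := prim_root_norm pw.
pose wpt (f : {ffun 'I_n -> 'I_m}) : 'rV[R[i]]_n := \row_i w ^+ f i.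
have tw f : torus (wpt f) by move=> i; rewrite mxE normrX w1 expr1n.
(* The denominator cancels the factor produced by [fejer_sum_row]; the root of the weight [c f] is
   absorbed into the kernel. *)
pose c f := trig_eval q (wpt f) / ((m * N) ^ n)%:R.
have c0 f : 0 <= c f by rewrite divr_ge0 ?ler0n ?q0.
exists [seq analytic_kernel N (sqrtC (c f)) (fun i => (w ^+ f i)^-1)
       | f : {ffun 'I_n -> 'I_m}] => z tz.
rewrite big_image/=.
under eq_bigr => f _.
  rewrite analytic_kernelE normrM exprMn ger0_norm ?sqrtC_ge0// sqrtCK.
  rewrite /c /trig_eval mulrAC mulr_suml.
  over.
(* With the sums exchanged, the grid is summed separately for each monomial of [q]. *)
rewrite /= -mulr_suml exchange_big mulr_suml /fejer_mean trig_eval_sum.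
apply: eq_big_seq => a aq; rewrite trig_evalZ trig_evalU mulrCA.
under [in RHS]eq_bigr do rewrite -mulrA.
rewrite -mulr_sumr -mulrA; congr (_ * _).
rewrite (fejer_sum_row _ _ N0 pw _ tz).
  by rewrite mulrAC mulfV ?mul1r// pnatr_eq0 -lt0n expn_gt0 muln_gt0 m0 N0.
move=> i; rewrite leq_add2r /A (big_rem a aq)/= (bigD1 i)//=.
by rewrite -addnA leq_addr.
Qed.

End Mean.
End FejerMean.

(** * Seminorms and complex moduli *)

Section SeminormTheory.
Context {R : realType} {V : lmodType R[i]} {nu : V -> R}.
Hypothesis nu_seminorm : seminorm nu.

Lemma seminorm0 : nu 0 = 0.
Proof. by rewrite -(scale0r 0) nu_seminorm.2 Normc.normc0 mul0r. Qed.

Lemma seminorm_ge0 x : 0 <= nu x.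
Proof.
have nuN : nu (- x) = nu x.
  by rewrite -scaleN1r nu_seminorm.2 normcN Normc.normc1 mul1r.
have := nu_seminorm.1 x (- x); rewrite subrr seminorm0 nuN; lra.
Qed.

Lemma seminorm_sum (I : Type) (r : seq I) (F : I -> V) :
  nu (\sum_(i <- r) F i) <= \sum_(i <- r) nu (F i).
Proof.
elim: r => [|i r IH]; first by rewrite !big_nil seminorm0.
by rewrite !big_cons (le_trans (nu_seminorm.1 _ _))// lerD2l.
Qed.

End SeminormTheory.

Lemma normc_real {R : rcfType} (x : R) : Normc.normc (x%:C)%C = `|x|.
Proof. by rewrite /Normc.normc/= expr0n addr0 sqrtr_sqr. Qed.

Lemma normr_complexE {R : rcfType} (x : R[i]) : `|x| = ((Normc.normc x)%:C)%C.
Proof. by []. Qed.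

Lemma normc_ge0 {R : rcfType} (x : R[i]) : 0 <= Normc.normc x.
Proof. by case: x => x y; exact: sqrtr_ge0. Qed.

(** * Density in the three topologies *)

Section Density.
Context {R : realType} {n : nat} {T : set 'rV[int]_n}.
Implicit Types p q : trigpoly R T.

(** The constant, independent of [N], in the [1 / N] estimate of [fejer_mean_close]. *)
Definition fejer_defect (nu : trigpoly R T -> R) q : R :=
  \sum_(a <- msupp q)
    (\sum_i `|val a ord0 i|%N)%:R * nu (mkmalgU a (mcoeff a q)).

Lemma fejer_mean_close (nu : trigpoly R T -> R) N q :
  seminorm nu -> (0 < N)%N ->
  nu (fejer_mean N q - q) <= fejer_defect nu q / N%:R.
Proof.
move=> snu N0; rewrite [X in _ - X]monalgE -sumrB /fejer_defect mulr_suml.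
apply: le_trans (seminorm_sum snu _ _ _) _; apply: ler_sum => a _.
rewrite -[X in _ - X]scale1r -scalerBl snu.2 mulrAC.
apply: ler_wpM2r; first exact: seminorm_ge0.
have -> (x : R) : (x%:C - 1 = (x - 1)%:C)%C by rewrite [RHS]rmorphB.
by rewrite normc_real fejer_coef_close.
Qed.

Lemma fejer_defect_ge0 nu q : seminorm nu -> 0 <= fejer_defect nu q.
Proof.
by move=> snu; apply: sumr_ge0 => a _; rewrite mulr_ge0 ?ler0n ?seminorm_ge0.
Qed.

Lemma sos_nonneg : sos_trigpoly (R := R) T `<=` nonneg_trigpoly T.
Proof.
move=> q [s qs] z tz; rewrite qs//; apply: sumr_ge0 => r _.
by rewrite exprn_ge0.
Qed.

Lemma exists_div_natr_lt (d e : R) : 0 <= d -> 0 < e ->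
  exists2 N : nat, (0 < N)%N & d / N%:R < e.
Proof.
move=> d0 e0; exists (Num.bound (d / e)).+1 => //.
rewrite ltr_pdivrMr ?ltr0n// mulrC -ltr_pdivrMr//.
apply: lt_le_trans (archi_boundP _) _; first by rewrite divr_ge0// ltW.
by rewrite ler_nat.
Qed.

Lemma sos_dense_seminorms (S : set (trigpoly R T -> R)) :
  S `<=` [set nu | seminorm nu] ->
  dense_in (sos_trigpoly T : set (seminorm_space S)) (nonneg_trigpoly T).
Proof.
move=> S_seminorm; split; first exact: sos_nonneg.
move=> q q0 B; rewrite nbhsE => -[U [oU Uq] UB].
have [m [nu [e [e0 Snu nuU]]]] := oU _ Uq.
have snu i : seminorm (nu i) by exact: S_seminorm.
have d0 i : 0 <= fejer_defect (nu i) q by exact: fejer_defect_ge0.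
(* A basic neighbourhood involves finitely many seminorms; the sum of their nonnegative defects
   dominates each one, so a single [N] suffices. *)
have [|N N0 Ne] := @exists_div_natr_lt (\sum_i fejer_defect (nu i) q) e _ e0.
  exact: sumr_ge0.
exists (fejer_mean N q); split; first exact: fejer_mean_sos.
apply/UB/nuU => i; apply: le_lt_trans Ne.
apply: le_trans (fejer_mean_close _ _ _ (snu i) N0) _.
rewrite ler_wpM2r ?invr_ge0 ?ler0n// (bigD1 i)//= lerDl.
exact: sumr_ge0.
Qed.

Lemma trig_eval_seminorm z :
  seminorm (fun p : trigpoly R T => Normc.normc (trig_eval p z)).
Proof.
split=> [p q|c p]; first by rewrite trig_evalD le_normcD.
by rewrite trig_evalZ Normc.normcM.
Qed.

Lemma normc_zmonom (z : 'rV[R[i]]_n) (a : 'rV[int]_n) :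
  torus z -> Normc.normc (zmonom z a) = 1.
Proof.
move=> tz; apply: complexI; rewrite -normr_complexE normr_prod big1// => i _.
have z0 : z ord0 i != 0 by rewrite -normr_eq0 tz oner_eq0.
case: (a ord0 i) => k; rewrite ?NegzE -?invr_expz -exprnP ?normfV normrX tz.
  by rewrite expr1n.
by rewrite expr1n invr1.
Qed.

(** Each point [z] of the torus gives the seminorm [|p z|]. Since [|z ^ a| = 1], all of them have
    the same defect [d] at [q], so the choice of [N] is uniform in [z]. *)
Lemma sos_dense_unif :
  dense_in (sos_trigpoly T : set (unif_conv R T)) (nonneg_trigpoly T).
Proof.
split; first exact: sos_nonneg.
move=> q q0 B; rewrite nbhsE => -[U [[O oO <-] Oq] UB].
have /uniform_nbhs[E [entE EO]] := open_nbhs_nbhs (conj oO Oq).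
move: entE; rewrite -entourage_from_ballE => -[e /= e0 eE].
(* The radius [e] lives in [R[i]]; being positive there, it is real. *)
have eE' : e = ((complex.Re e)%:C)%C.
  by case: e e0 {eE} => x y; rewrite ltcE/= => /andP[/eqP ->].
have Re0 : 0 < complex.Re e by move: e0; rewrite eE' ltcR.
pose d := \sum_(a <- msupp q)
    (\sum_i `|val a ord0 i|%N)%:R * Normc.normc (mcoeff a q).
have dE z : torus z ->
    fejer_defect (fun p => Normc.normc (trig_eval p z)) q = d.
  move=> tz; apply: eq_bigr => a _.
  by rewrite trig_evalU Normc.normcM normc_zmonom// mulr1.
have [|N N0 Ne] := @exists_div_natr_lt d (complex.Re e) _ Re0.
  by apply: sumr_ge0 => a _; rewrite mulr_ge0 ?ler0n ?normc_ge0.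
exists (fejer_mean N q); split; first exact: fejer_mean_sos.
apply/UB/EO => z tz; apply: eE => /=.
rewrite -ball_normE/= distrC -trig_evalB normr_complexE eE' ltcR.
apply: le_lt_trans Ne; rewrite -(dE z tz).
exact: (fejer_mean_close _ _ _ (trig_eval_seminorm z) N0).
Qed.

Lemma mcoeff_le_co_norm p a : Normc.normc (mcoeff a p) <= co_norm p.
Proof.
have [ap|/mcoeff_outdom ->] := boolP (a \in msupp p).
  exact: (le_bigmax_seq 0 a xpredT (fun a => Normc.normc (mcoeff a p))).
by rewrite Normc.normc0; exact: bigmax_ge_id.
Qed.

Lemma co_norm_le p (x : R) : 0 <= x ->
  (forall a, Normc.normc (mcoeff a p) <= x) -> co_norm p <= x.
Proof. by move=> x0 px; apply: bigmax_le. Qed.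

Lemma co_norm_seminorm : seminorm (@co_norm R n T).
Proof.
have ge0 p : 0 <= co_norm p by exact: bigmax_ge_id.
split=> [p q|c p].
  apply: co_norm_le => [|a]; first exact: addr_ge0.
  rewrite mcoeffD; apply: le_trans (le_normcD _ _) _.
  by rewrite lerD ?mcoeff_le_co_norm.
(* [co_norm_le] gives only upper bounds, so the lower bound for the norm of [c *: p] comes from
   dividing by [|c|]; the case [c = 0] is treated first. *)
have [->|c0] := eqVneq c 0.
  rewrite scale0r Normc.normc0 mul0r; apply/le_anti; rewrite ge0 andbT.
  by apply: co_norm_le => // a; rewrite mcoeff0 Normc.normc0.
have nc0 : 0 < Normc.normc c.
  rewrite lt_def normc_ge0 andbT; apply: contra c0 => /eqP/Normc.eq0_normc c0.
  exact/eqP.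
apply/le_anti/andP; split.
  apply: co_norm_le => [|a]; first by rewrite mulr_ge0 ?normc_ge0.
  by rewrite mcoeffZ Normc.normcM ler_wpM2l ?normc_ge0 ?mcoeff_le_co_norm.
rewrite mulrC -ler_pdivlMr//; apply: co_norm_le => [|a].
  by rewrite divr_ge0 ?normc_ge0.
rewrite ler_pdivlMr// mulrC -Normc.normcM -mcoeffZ.
exact: mcoeff_le_co_norm.
Qed.

End Density.

Theorem proposition38 (R : realType) (n : nat) (n_gt0 : (0 < n)%N)
    (T : set 'rV[int]_n) (T0 : T 0) (TN : [set - a | a in T] = T) :
  [/\ dense_in (sos_trigpoly T : set (finest_lc (trigpoly R T)))
               (nonneg_trigpoly T),
      dense_in (sos_trigpoly T : set (unif_conv R T))
               (nonneg_trigpoly T)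
    & dense_in (sos_trigpoly T : set (co_normed R T))
               (nonneg_trigpoly T)].
Proof.
split.
- exact: sos_dense_seminorms.
- exact: sos_dense_unif.
- by apply: sos_dense_seminorms => _ ->; exact: co_norm_seminorm.
Qed.
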